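(* Let $k\ge 3$ be an integer, let $S_k$ be the star graph with adjacency eigenvalues $\mu_i$, $i=1,\dots,k$, and let $G^{(1)}=S_k\circ S_k$. The adjacency spectrum $\sigma(G^{(1)})$ consists of the following eigenvalues. (a) $\lambda_z=X^z+\frac{\mu_i}{3}\in\sigma(G^{(1)})$ with multiplicity $1$; (b) $0\in\sigma(G^{(1)})$ with multiplicity $k(k-2)$. Here $z=1,2,3$ correspond to the three angles $\frac{\theta}{3},\frac{2\pi+\theta}{3},\frac{4\pi+\theta}{3}$, namely $$X^z=\frac23\cos\Bigl(\frac{y\pi+\theta}{3}\Bigr)\sqrt{\mu_i^2+(6k-3)},\qquad y=0,2,4,$$ $$\theta=\cos^{-1}\left(\frac{2\mu_i^3+\mu_i(18-9k)+(54k-54)}{2\bigl(\mu_i^2+(6k-3)\bigr)^{3/2}}\right).$$ Moreover, $$\lambda_z\in\Bigl[-\mu_i+\frac{2\mu_i}{3}-\frac{2\sqrt{6k-3}}{3},\ \mu_i+\frac{2\sqrt{6k-3}}{3}\Bigr].$$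
   Context: The star graph $S_k$ has $k$ nodes: one center joined to $k-1$ leaves. The corona product $G_1\circ G_2$ of two graphs is obtained by taking one copy of $G_1$ and $|V(G_1)|$ copies of $G_2$, and joining the $i$-th node of $G_1$ to every node of the $i$-th copy of $G_2$, for each $i$. $\sigma(H)$ denotes the spectrum of the adjacency matrix of $H$.
   Formalization: In the final interval μ_i is replaced by |μ_i|, since as printed the claim fails for the negative eigenvalue μ_i = −√(k−1) (k=3: a λ_z ≈ 2.221 exceeds the upper end ≈ 1.168); multiplicities are counted per pair (i, z), coincidences adding up. *)

(* Defs.v *)
From HB Require Import structures.
From mathcomp Require Import all_boot all_order all_algebra.
From mathcomp Require Import all_classical all_reals all_analysis.

Set Implicit Arguments.
Unset Strict Implicit.
Unset Printing Implicit Defensive.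

Import Order.TTheory GRing.Theory Num.Theory.

Local Open Scope ring_scope.

Record sgraph := SGraph {
  vertex : finType;
  edge : rel vertex;
  edge_sym : symmetric edge;
  edge_irrefl : irreflexive edge }.

Section Star.
Variable k : nat.

(* The center is the vertex of value 0. *)
Definition star_edge : rel 'I_k :=
  fun i j => (i != j) && ((val i == 0%N) || (val j == 0%N)).

Lemma star_edge_sym : symmetric star_edge.
Proof. by move=> i j; rewrite /star_edge eq_sym orbC. Qed.

Lemma star_edge_irrefl : irreflexive star_edge.
Proof. by move=> i; rewrite /star_edge eqxx. Qed.

Definition star : sgraph := SGraph star_edge_sym star_edge_irrefl.

End Star.

Section Corona.
Variables G1 G2 : sgraph.

(* inl u is the vertex u of G1; inr (u, v) is the vertex v of the copy of G2
   attached to u. *)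
Definition corona_edge : rel (vertex G1 + vertex G1 * vertex G2)%type :=
  fun a b => match a, b with
  | inl u, inl u' => edge u u'
  | inl u, inr (u', _) => u == u'
  | inr (u, _), inl u' => u == u'
  | inr (u, v), inr (u', v') => (u == u') && edge v v'
  end.

Lemma corona_edge_sym : symmetric corona_edge.
Proof.
by move=> [u|[u v]] [u'|[u' v']] //=; rewrite 1?eq_sym // edge_sym.
Qed.

Lemma corona_edge_irrefl : irreflexive corona_edge.
Proof. by move=> [u|[u v]] /=; rewrite edge_irrefl ?andbF. Qed.

Definition corona : sgraph := SGraph corona_edge_sym corona_edge_irrefl.

End Corona.

Definition adjmx (R : realType) (G : sgraph) : 'M[R]_#|vertex G| :=
  \matrix_(i, j) (edge (enum_val i) (enum_val j))%:R.

(* s lists the spectrum of A as a multiset, i.e., the eigenvalues of A, each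
   repeated according to its multiplicity; the order of s is irrelevant. *)
Definition is_spectrum (R : realType) (n : nat) (A : 'M[R]_n) (s : seq R) :=
  char_poly A = \prod_(x <- s) ('X - x%:P).

Definition theta (R : realType) (k : nat) (mu : R) : R :=
  acos ((2 * mu ^+ 3 + mu * (18 - 9 * k%:R) + (54 * k%:R - 54))
        / (2 * (mu ^+ 2 + (6 * k%:R - 3)) `^ (3 / 2))).

(* z = 0, 1, 2 gives the angles theta/3, (2 pi + theta)/3, (4 pi + theta)/3. *)
Definition Xroot (R : realType) (k : nat) (mu : R) (z : 'I_3) : R :=
  2 / 3 * cos (((2 * z)%N%:R * pi + theta k mu) / 3)
        * Num.sqrt (mu ^+ 2 + (6 * k%:R - 3)).

Definition lambda (R : realType) (k : nat) (mu : R) (z : 'I_3) : R :=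
  Xroot k mu z + mu / 3.

(* Main.v *)
(* At a real x outside the spectrum of S_k, the Schur complement with respect to
   the copies of S_k gives
     det (x - A) = det (x - chi - A_1) * det (x - A_1) ^ k,
   where A_1 is the adjacency matrix of S_k and chi = 1^T (x - A_1)^-1 1.
   Another Schur complement gives det (x - A_1) = x^(k-2) (x^2 - (k - 1)) and
   solving a linear system gives chi = (k x + 2 (k - 1)) / (x^2 - (k - 1)), so
   every mu_i contributes x^(k-2) times the cubic
     (x - mu_i) (x^2 - (k - 1)) - k x - 2 (k - 1),
   whose three real roots are given by the trigonometric solution.
   The lower end of the interval needs mu_i = 0 or mu_i^2 = k - 1. *)
Require Import Defs.
From HB Require Import structures.
From mathcomp Require Import all_boot all_order all_fingroup all_algebra.
From mathcomp Require Import all_classical all_reals all_analysis.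
From mathcomp Require Import ring lra.
Set Implicit Arguments.
Unset Strict Implicit.
Unset Printing Implicit Defensive.
Import Order.TTheory GRing.Theory Num.Theory.
Local Open Scope ring_scope.

(** * Determinants indexed by finite types *)

Section FinDet.
Variable R : comNzRingType.

(** Indexing by the type itself lets blocks be read off from a sum or a product of types, as for the
    vertices of a corona. *)
Definition fdet (T : finType) (F : T -> T -> R) : R :=
  \det (\matrix_(i, j < #|T|) F (enum_val i) (enum_val j)).

Lemma eq_fdet (T : finType) (F G : T -> T -> R) : F =2 G -> fdet F = fdet G.
Proof. by move=> eqFG; congr (\det _); apply/matrixP=> i j; rewrite !mxE. Qed.

(** Rows and columns undergo the same permutation, so its sign occurs twice and cancels. *)
Lemma fdet_bij (n : nat) (T : finType) (f : 'I_n -> T) (F : T -> T -> R) :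
  bijective f -> \det (\matrix_(i, j < n) F (f i) (f j)) = fdet F.
Proof.
move=> f_bij; have eqn : n = #|T| by rewrite -(bij_eq_card f_bij) card_ord.
subst n; have s_inj : injective (enum_rank \o f).
  by apply: inj_comp; [apply: enum_rank_inj | apply: bij_inj].
pose s := perm s_inj.
pose A := \matrix_(i, j < #|T|) F (enum_val i) (enum_val j).
have -> : \matrix_(i, j) F (f i) (f j) = row_perm s (col_perm s A).
  by apply/matrixP=> i j; rewrite !mxE !permE /= !enum_rankK.
rewrite row_permE col_permE !det_mulmx !det_perm /fdet -/A odd_permV mulrCA.
by rewrite -signr_addb addbb mulr1.
Qed.

Lemma fdet_reindex (T T' : finType) (h : T -> T') (F : T' -> T' -> R) :
  bijective h -> fdet (fun x y => F (h x) (h y)) = fdet F.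
Proof.
move=> h_bij; rewrite -(@fdet_bij _ _ (h \o @enum_val T T)) //.
by apply: bij_comp => //; apply: enum_val_bij.
Qed.

Lemma fdet_scalar (T : finType) (x : R) :
  fdet (fun i j : T => x *+ (i == j)) = x ^+ #|T|.
Proof.
rewrite -det_scalar; congr (\det _); apply/matrixP=> i j.
by rewrite !mxE (inj_eq enum_val_inj).
Qed.

(** With lower blocks [C] and [D], a solution [Y] of [D Y = C] stands in for [D^-1 C], so no inverse
    is formed: right multiplication by a unitriangular matrix with block [- Y] clears [C]. *)
Lemma fdet_schur (T1 T2 : finType) (F : T1 + T2 -> T1 + T2 -> R)
    (Y : T2 -> T1 -> R) :
  (forall v u, \sum_w F (inr v) (inr w) * Y w u = F (inr v) (inl u)) ->
  fdet F = fdet (fun u u' => F (inl u) (inl u')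
                             - \sum_w F (inl u) (inr w) * Y w u')
           * fdet (fun v v' => F (inr v) (inr v')).
Proof.
move=> FY.
pose f (i : 'I_(#|T1| + #|T2|)) : T1 + T2 :=
  match fintype.split i with inl a => inl (enum_val a) | inr b => inr (enum_val b) end.
have f_bij : bijective f.
  pose g (s : T1 + T2) : 'I_(#|T1| + #|T2|) :=
    unsplit match s with inl a => inl (enum_rank a) | inr b => inr (enum_rank b) end.
  exists g => [i|[a|b]]; rewrite /f /g ?unsplitK ?enum_rankK //.
  by case: (fintype.split i) (splitK i) => a <-; rewrite enum_valK.
rewrite -(fdet_bij F f_bij).
pose B := \matrix_(i < #|T1|, j < #|T2|) F (inl (enum_val i)) (inr (enum_val j)).
pose D := \matrix_(i < #|T2|, j < #|T2|) F (inr (enum_val i)) (inr (enum_val j)).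
pose A := \matrix_(i < #|T1|, j < #|T1|) F (inl (enum_val i)) (inl (enum_val j)).
pose Z := \matrix_(i < #|T2|, j < #|T1|) Y (enum_val i) (enum_val j).
have -> : \matrix_(i, j) F (f i) (f j) = block_mx A B (D *m Z) D.
  apply/matrixP=> i j; rewrite !mxE /f.
  case: (splitP i) => a _; rewrite !mxE; case: (splitP j) => b _; rewrite !mxE //.
  rewrite -FY (reindex (@enum_val T2 T2)) /=; last exact/onW_bij/enum_val_bij.
  by apply: eq_bigr => w _; rewrite !mxE.
transitivity (\det (block_mx A B (D *m Z) D *m block_mx 1%:M 0 (- Z) 1%:M)).
  by rewrite det_mulmx det_lblock !det1 !mulr1.
rewrite mulmx_block !mulmx1 !mulmx0 !add0r !mulmxN subrr det_ublock.
congr (\det _ * _); apply/matrixP=> i j; rewrite !mxE; congr (_ + _).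
congr (- _).
rewrite (reindex (@enum_val T2 T2)) /=; last exact/onW_bij/enum_val_bij.
by apply: eq_bigr => w _; rewrite !mxE.
Qed.

(** The matrix is block diagonal with equal blocks; induction splits off one block at a time, by a
    Schur complement with [Y = 0]. *)
Lemma fdet_kron1 (T1 T2 : finType) (F : T2 -> T2 -> R) :
  fdet (fun p q : T1 * T2 => (p.1 == q.1)%:R * F p.2 q.2) = fdet F ^+ #|T1|.
Proof.
suff IH n : fdet (fun p q : 'I_n * T2 => (p.1 == q.1)%:R * F p.2 q.2)
            = fdet F ^+ n.
  rewrite -IH; pose h (p : 'I_#|T1| * T2) : T1 * T2 := (enum_val p.1, p.2).
  have h_bij : bijective h.
    exists (fun p => (enum_rank p.1, p.2)) => -[a b]; rewrite /h /=.
      by rewrite enum_valK.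
    by rewrite enum_rankK.
  rewrite -(fdet_reindex _ h_bij); apply: eq_fdet => p q /=.
  by rewrite (inj_eq enum_val_inj).
elim: n => [|n IHn].
  rewrite expr0 /fdet; set A := (X in \det X); move: A.
  by rewrite card_prod card_ord mul0n => A; rewrite det_mx00.
pose h (s : T2 + 'I_n * T2) : 'I_n.+1 * T2 :=
  match s with inl v => (ord0, v) | inr p => (lift ord0 p.1, p.2) end.
have h_bij : bijective h.
  exists (fun p => match unlift ord0 p.1 with
                   | None => inl p.2 | Some i => inr (i, p.2) end).
    by move=> [v|[i v]] /=; rewrite ?unlift_none ?liftK.
  by move=> [i v] /=; case: unliftP => [j|] ->.
rewrite -(fdet_reindex _ h_bij) (fdet_schur (Y := fun _ _ => 0)) /=; last first.
  by move=> [i v] u; rewrite big1 ?mul0r // => w _; rewrite mulr0.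
rewrite exprS -IHn; congr (_ * _); apply: eq_fdet => p q.
by rewrite mul1r big1 ?subr0 // => w _; rewrite mulr0.
Qed.

End FinDet.

(** * Characteristic polynomials of coronas and stars *)

Section CharPoly.
Variable R : realType.

Lemma horner_char_poly_adjmx (G : sgraph) (x : R) :
  (char_poly (adjmx R G)).[x]
  = fdet (fun u v : vertex G => x *+ (u == v) - (edge u v)%:R).
Proof.
rewrite -[LHS]/(horner_eval x _) /char_poly -det_map_mx; congr (\det _).
apply/matrixP=> i j; rewrite !mxE /= horner_evalE (inj_eq enum_val_inj).
by rewrite hornerD hornerN hornerMn hornerX hornerC.
Qed.

(* The sum of y is the coronal of G2 at x, i.e. 1^T (x - A2)^-1 1. *)
Lemma horner_char_poly_corona (G1 G2 : sgraph) (x : R) (y : vertex G2 -> R) :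
  (forall v, \sum_w (x *+ (v == w) - (edge v w)%:R) * y w = 1) ->
  (char_poly (adjmx R (corona G1 G2))).[x]
  = (char_poly (adjmx R G1)).[x - \sum_w y w]
    * (char_poly (adjmx R G2)).[x] ^+ #|vertex G1|.
Proof.
move=> Ny; rewrite !horner_char_poly_adjmx.
(* Column [u] of the lower left block is -1 on the copy attached to [u] and 0 elsewhere, so its
   solution is [- y] on that copy. *)
rewrite (fdet_schur (Y := fun (p : vertex G1 * vertex G2) u =>
                            - ((p.1 == u)%:R * y p.2))); last first.
  move=> [a v] u /=.
  rewrite (eq_bigr (fun p : vertex G1 * vertex G2 => - ((a == p.1)%:R * (p.1 == u)%:R
            * ((x *+ (v == p.2) - (edge v p.2)%:R) * y p.2)))); last first.
    move=> [b w] _ /=; rewrite -[inr _ == _]/((a, v) == (b, w)) xpair_eqE.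
    by case: (a == b); rewrite /= ?mul1r ?mulr0n ?subr0 ?mul0r ?oppr0 // mulrN mulrCA.
  rewrite sumrN mulr0n sub0r; congr (- _).
  rewrite -(pair_bigA _ (fun b w => (a == b)%:R * (b == u)%:R
            * ((x *+ (v == w) - (edge v w)%:R) * y w))) /=.
  rewrite (bigD1 a) //= [X in _ + X]big1 ?addr0; last first.
    by move=> b /negPf nb; rewrite eq_sym nb big1 // => w _; rewrite !mul0r.
  by rewrite -big_distrr /= Ny eqxx mul1r mulr1.
rewrite -(fdet_kron1 (vertex G1)); congr (_ * _).
  apply: eq_fdet => u u' /=.
  rewrite (eq_bigr (fun p : vertex G1 * vertex G2 =>
                      (u == p.1)%:R * (p.1 == u')%:R * y p.2)); last first.
    by move=> [b w] _ /=; rewrite mulr0n sub0r mulrNN mulrA.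
  rewrite -(pair_bigA _ (fun b w => (u == b)%:R * (b == u')%:R * y w)) /=.
  rewrite (bigD1 u) //= [X in _ - (_ + X)]big1 ?addr0; last first.
    by move=> b /negPf nb; rewrite eq_sym nb big1 // => w _; rewrite !mul0r.
  rewrite eqxx mul1r -big_distrr /= -[inl _ == _]/(u == u') mulrnBl mulr_natl.
  by rewrite addrAC.
apply: eq_fdet => -[u v] [u' v'] /=; rewrite -[inr _ == _]/((u, v) == (u', v')).
by rewrite xpair_eqE; case: (u == u'); rewrite ?mul1r ?mul0r ?mulr0n ?subr0.
Qed.

(** The [n.+1] leaves are pairwise non-adjacent, so their block is [x] times the identity, and its
    Schur complement is the scalar [x - n.+1 / x]. *)
Lemma horner_char_poly_star (n : nat) (x : R) : x != 0 ->
  (char_poly (adjmx R (star n.+2))).[x] = x ^+ n * (x ^+ 2 - n.+1%:R).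
Proof.
move=> x0; rewrite horner_char_poly_adjmx /=.
pose h (s : unit + 'I_n.+1) : 'I_n.+2 :=
  match s with inl _ => ord0 | inr p => lift ord0 p end.
have h_bij : bijective h.
  exists (fun i => match unlift ord0 i with
                   | None => inl tt | Some i => inr i end).
    by move=> [[]|i] /=; rewrite ?unlift_none ?liftK.
  by move=> i /=; case: unliftP => [j|] ->.
rewrite -(fdet_reindex _ h_bij) (fdet_schur (Y := fun _ _ => - x^-1)) /=; last first.
  move=> v _; rewrite (bigD1 v) //= big1 ?addr0.
    by rewrite eqxx mulr1n /star_edge /= eqxx /= subr0 mulr0n sub0r mulrN divff.
  move=> w /negPf nw; rewrite (inj_eq lift_inj) eq_sym nw /star_edge /= andbF subr0.
  by rewrite mulr0n mul0r.
rewrite (eq_fdet (G := fun v v' : 'I_n.+1 => x *+ (v == v'))); last first.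
  by move=> v v'; rewrite /= /star_edge andbF subr0.
rewrite (eq_fdet (G := fun i j : unit => (x - n.+1%:R * x^-1) *+ (i == j))); last first.
  move=> [] [] /=; rewrite !mulr1n subr0; congr (_ - _).
  rewrite (eq_bigr (fun=> x^-1)); last by move=> w _; rewrite mulr0n sub0r mulrNN mul1r.
  by rewrite sumr_const card_ord mulr_natl.
rewrite !fdet_scalar card_unit card_ord expr1 exprS mulrA mulrBl -mulrA mulVf // mulr1.
by rewrite mulrC -expr2.
Qed.

End CharPoly.

(** * Trigonometric solution of the cubic, and bounds on its roots *)

Section Cubic.
Variable R : realType.
Implicit Types (a b p q r t x phi s : R).

(** Doubling the angle gives its opposite modulo [2 * pi], so the cosine [c] satisfies
    [2 c^2 - 1 = c]; injectivity of [cos] on [0, pi] excludes [c = 1]. *)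
Lemma cos_2pi3 : cos (2 * pi / 3) = - (1 / 2) :> R.
Proof.
set c := cos _; have pi0 := pi_gt0 R.
have c4 : cos (2 * pi / 3 *+ 2) = c.
  have -> : 2 * pi / 3 *+ 2 = - (2 * pi / 3) + pi *+ 2 :> R.
    by rewrite !mulr2n; field.
  by rewrite cosD2pi cosN.
have c1 : c != 1.
  apply/eqP; rewrite -(cos0 R) => /cos_inj; rewrite !in_itv /= => e.
  by have : 2 * pi / 3 = 0 :> R; [apply: e; apply/andP; split; lra|lra].
move: c4; rewrite cos_mulr2n -/c => c4.
have /eqP : (c - 1) * (c + 1 / 2) = 0.
  transitivity ((c ^+ 2 *+ 2 - 1 - c) / 2); first by rewrite mulr2n; field.
  by rewrite c4 subrr mul0r.
by rewrite mulf_eq0 subr_eq0 (negPf c1) /= addr_eq0 => /eqP.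
Qed.

(** The three cosines are the roots of [4 c^3 - 3 c = cos (3 phi)]. By the addition formulas, the
    two shifted factors multiply to a difference of squares. *)
Lemma cos_triple_prod a t phi :
  \prod_(z < 3) (t - a * cos (phi + (z%:R * (2 * pi / 3))))
  = t ^+ 3 - 3 / 4 * a ^+ 2 * t - a ^+ 3 / 4 * cos (phi *+ 3).
Proof.
rewrite !big_ord_recl big_ord0 /bump /= mulr0n mul0r addr0 mulr1n mul1r mulr1.
set o := 2 * pi / 3.
have co : cos o = - (1 / 2) by exact: cos_2pi3.
have so := cos2Dsin2 o; rewrite co in so.
have -> : cos (phi *+ 3) = 4 * cos phi ^+ 3 - 3 * cos phi.
  rewrite mulrS cosD cos_mulr2n sin_mulr2n.
  have := cos2Dsin2 phi; rewrite !mulr2n; set C := cos phi; set S := sin phi => e.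
  transitivity (C * (C ^+ 2 + C ^+ 2 - 1) - 2 * C * S ^+ 2); first by ring.
  by rewrite -[S ^+ 2](addKr (C ^+ 2)) e; ring.
have c4 : cos (2 * o) = - (1 / 2).
  by rewrite mulr_natl cos_mulr2n co mulr2n; field.
have s4 : sin (2 * o) = - sin o by rewrite mulr_natl sin_mulr2n co mulr2n; field.
rewrite !cosD c4 s4 co.
have e := cos2Dsin2 phi.
set C := cos phi in e *; set S := sin phi in e *; set T := sin o in so *.
have T2 : T ^+ 2 = 3 / 4 by lra.
have S2 : S ^+ 2 = 1 - C ^+ 2 by lra.
have -> : (t - a * C) * ((t - a * (C * - (1 / 2) - S * T)) * (t - a * (C * - (1 / 2) - S * - T)))
  = (t - a * C) * ((t + a * C / 2) ^+ 2 - a ^+ 2 * (S ^+ 2 * T ^+ 2)).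
  by field.
by rewrite S2 T2; field.
Qed.

(** A weak descent from [a] to [b] forces [a^2 + a b + b^2 <= 3 r^2]. If [q] were too small, [a] and
    hence [b] would exceed [2 r]; if too large, both would lie below [- 2 r]. *)
Lemma depressed_cubic_bound q r a b : 0 <= r -> a < b ->
  b ^+ 3 - 3 * r ^+ 2 * b + q <= 0 <= a ^+ 3 - 3 * r ^+ 2 * a + q ->
  `|q| <= 2 * r ^+ 3.
Proof.
move=> r0 ab /andP[gb ga].
have key : a ^+ 2 + a * b + b ^+ 2 <= 3 * r ^+ 2.
  rewrite leNgt; apply/negP => h.
  have : 0 < (b - a) * (a ^+ 2 + a * b + b ^+ 2 - 3 * r ^+ 2).
    by rewrite mulr_gt0 ?subr_gt0.
  nra.
rewrite ler_norml; apply/andP; split.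
  rewrite leNgt; apply/negP => h.
  have : 0 < (a + r) ^+ 2 * (a - 2 * r).
    have -> : (a + r) ^+ 2 * (a - 2 * r) = a ^+ 3 - 3 * r ^+ 2 * a - 2 * r ^+ 3 by ring.
    lra.
  move=> h1; have a2 : 2 * r < a.
    by rewrite ltNge; apply/negP => h2; have := sqr_ge0 (a + r); nra.
  nra.
rewrite leNgt; apply/negP => h.
have : (b - r) ^+ 2 * (b + 2 * r) < 0.
  have -> : (b - r) ^+ 2 * (b + 2 * r) = b ^+ 3 - 3 * r ^+ 2 * b + 2 * r ^+ 3 by ring.
  lra.
move=> h1; have b2 : b < - 2 * r.
  by rewrite ltNge; apply/negP => h2; have := sqr_ge0 (b - r); nra.
nra.
Qed.

(* The right-hand side is x - m minus the coronal of S_k at x, multiplied by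
   the denominator x ^ 2 - (k - 1) of the latter. *)
Lemma prod_lambda (k : nat) (m x : R) : (3 <= k)%N ->
  \prod_(z < 3) (x - lambda k m z)
  = (x - m) * (x ^+ 2 - (k%:R - 1)) - k%:R * x - 2 * (k%:R - 1).
Proof.
move=> k3; have K3 : 3 <= k%:R :> R by rewrite (ler_nat R 3 k).
set K : R := k%:R in K3 *.
pose S := m ^+ 2 + (6 * K - 3); have S0 : 0 < S by rewrite /S; have := sqr_ge0 m; lra.
pose w := Num.sqrt S; have w0 : 0 < w by rewrite sqrtr_gt0.
have w2 : w ^+ 2 = S by rewrite sqr_sqrtr // ltW.
pose N := 2 * m ^+ 3 + m * (18 - 9 * K) + (54 * K - 54).
have pw : S `^ (3 / 2) = w ^+ 3.
  by rewrite mulrC powRrM powR12_sqrt ?ltW // -/w powR_mulrn // ltW.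
have cosN : cos (theta k m) = N / (2 * w ^+ 3).
  rewrite /theta -/K -/S pw -/N; apply: (acos_def _).2.
  have w3 : 0 < 2 * w ^+ 3 by rewrite mulr_gt0 // exprn_gt0.
  rewrite -ler_norml normrM normfV (gtr0_norm w3) ler_pdivrMr // mul1r.
  (* acos inverts cos here because the cubic has three real roots: it is
     nonnegative at - sqrt (k - 1) and nonpositive at sqrt (k - 1). *)
  pose s := Num.sqrt (K - 1).
  have s2 : s ^+ 2 = K - 1 by rewrite sqr_sqrtr //; lra.
  have s1 : 1 < s by rewrite -(sqrtr1 R) ltr_sqrt; lra.
  have KE : K = s ^+ 2 + 1 by lra.
  have : `|- N / 27| <= 2 * (w / 3) ^+ 3.
    (* The shift by [m / 3] removes the quadratic term; these points correspond to [x = - s] and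
       [x = s], where the cubic equals [s (s - 1)^2] and [- s (s + 1)^2]. *)
    apply: (@depressed_cubic_bound _ _ (- s - m / 3) (s - m / 3)).
    - by rewrite divr_ge0 // ltW.
    - lra.
    have -> : 3 * (w / 3) ^+ 2 = S / 3 by rewrite -w2; field.
    rewrite /N /S KE; apply/andP; split.
      rewrite [X in X <= _](_ : _ = - (s * (s + 1) ^+ 2)); last by field.
      by rewrite oppr_le0 mulr_ge0 ?sqr_ge0 //; lra.
    rewrite [X in _ <= X](_ : _ = s * (s - 1) ^+ 2); last by field.
    by rewrite mulr_ge0 ?sqr_ge0 //; lra.
  rewrite normrM normrN normfV (ger0_norm (_ : 0 <= 27)) // expr_div_n.
  have -> : 3 ^+ 3 = 27 :> R by ring.
  lra.
rewrite (eq_bigr (fun z : 'I_3 => (x - m / 3)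
   - 2 / 3 * w * cos (theta k m / 3 + z%:R * (2 * pi / 3)))); last first.
  move=> z _; rewrite /lambda /Xroot -/K -/S -/w natrM.
  have -> : (2 * z%:R * pi + theta k m) / 3 = theta k m / 3 + z%:R * (2 * pi / 3).
    by field.
  by ring.
rewrite cos_triple_prod -[theta k m / 3 *+ 3]mulr_natr divfK // cosN.
have -> : 3 / 4 * (2 / 3 * w) ^+ 2 = S / 3 by rewrite -w2; field.
have -> : (2 / 3 * w) ^+ 3 / 4 * (N / (2 * w ^+ 3)) = N / 27.
  by field; rewrite gt_eqF.
by rewrite /S /N; field.
Qed.

Lemma lambda_itv (k : nat) (m : R) (z : 'I_3) : (3 <= k)%N ->
  m = 0 \/ m ^+ 2 = k%:R - 1 ->
  lambda k m z \in `[- `|m| + 2 * `|m| / 3 - 2 * Num.sqrt (6 * k%:R - 3) / 3,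
                     `|m| + 2 * Num.sqrt (6 * k%:R - 3) / 3].
Proof.
move=> k3 mk; have K3 : 3 <= k%:R :> R by rewrite (ler_nat R 3 k).
(* Evaluating the product at one of its own roots yields the cubic equation for [lambda k m z]. *)
have := prod_lambda m (lambda k m z) k3.
rewrite (bigD1 z) //= subrr mul0r => /esym root_l.
move: root_l; rewrite /lambda /Xroot; move: mk.
set K : R := k%:R in K3 *.
set r := Num.sqrt (6 * K - 3); set w := Num.sqrt (m ^+ 2 + _).
have r2 : r ^+ 2 = 6 * K - 3 by rewrite sqr_sqrtr //; lra.
have w2 : w ^+ 2 = m ^+ 2 + r ^+ 2.
  by rewrite sqr_sqrtr ?r2 // addr_ge0 ?sqr_ge0 //; lra.
have r0 : 0 <= r by apply: sqrtr_ge0.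
have w0 : 0 <= w by apply: sqrtr_ge0.
set c := cos _; have cN1 : -1 <= c by apply: cos_geN1.
have c1 : c <= 1 by apply: cos_le1.
(* With [|t| <= 2 w / 3], this settles the upper end, and the lower end when [0 <= m]. *)
have wr : w <= `|m| + r.
  rewrite -(ler_pXn2r (n := 2)) ?nnegrE ?addr_ge0 // w2 sqrrD real_normK ?num_real //.
  by rewrite lerD2r lerDl mulrn_wge0 // mulr_ge0.
move=> mk; set t := 2 / 3 * c * w => root_l.
have tw : - (2 / 3 * w) <= t <= 2 / 3 * w by rewrite /t; apply/andP; split; nra.
rewrite in_itv /=; case/andP: tw => tw1 tw2.
have [m0|m0] := leP 0 m.
  rewrite ger0_norm // in wr *; apply/andP; split; lra.
rewrite ltr0_norm // in wr *; apply/andP; split; last lra.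
case: mk => [mz|mk]; first by rewrite mz ltxx in m0.
(* The depressed cubic g is negative at - 2 r / 3, which lies to the left of
   its critical points, hence g < 0 on the whole half-line below it. *)
suff : - (2 * r / 3) <= t by lra.
rewrite leNgt; apply/negP => tr.
pose s := - m; have s1 : 1 < s by rewrite /s; nra.
have KE : K = s ^+ 2 + 1 by rewrite /s sqrrN mk; lra.
have mE : m = - s by rewrite opprK.
have g0 : t ^+ 3 - (s ^+ 2 + r ^+ 2) / 3 * t + (- 7 * s ^+ 3 / 27 + s / 3 - 2 * s ^+ 2) = 0.
  by rewrite -root_l r2 KE mE; field.
have g1 : (- (2 * r / 3)) ^+ 3 - (s ^+ 2 + r ^+ 2) / 3 * (- (2 * r / 3))
   + (- 7 * s ^+ 3 / 27 + s / 3 - 2 * s ^+ 2) < 0.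
  have -> : (- (2 * r / 3)) ^+ 3 - (s ^+ 2 + r ^+ 2) / 3 * (- (2 * r / 3))
    = - 2 * r / 27 * (r ^+ 2 - 3 * s ^+ 2) by field.
  have -> : r ^+ 2 - 3 * s ^+ 2 = 3 * s ^+ 2 + 3 by rewrite r2 KE; ring.
  have h1 : 0 <= r * (3 * s ^+ 2 + 3) by rewrite mulr_ge0 //; have := sqr_ge0 s; lra.
  have h2 : 0 < s ^+ 3 by rewrite exprn_gt0 //; lra.
  have h3 : s < s ^+ 2 by rewrite expr2; nra.
  nra.
have rs : s ^+ 2 <= r ^+ 2 by rewrite r2 KE; have := sqr_ge0 s; lra.
pose d := - (2 * r / 3) - t; have d0 : 0 < d by rewrite /d; lra.
have tE : t = - (2 * r / 3) - d by rewrite /d; ring.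
have : t ^+ 3 - (s ^+ 2 + r ^+ 2) / 3 * t
  = (- (2 * r / 3)) ^+ 3 - (s ^+ 2 + r ^+ 2) / 3 * (- (2 * r / 3))
    - d * (d ^+ 2 + 2 * r * d + (r ^+ 2 - s ^+ 2 / 3)).
  by rewrite tE; field.
have : 0 <= d * (d ^+ 2 + 2 * r * d + (r ^+ 2 - s ^+ 2 / 3)).
  apply: mulr_ge0; first exact: ltW.
  have h1 : 0 <= 2 * r * d by rewrite mulr_ge0 ?mulr_ge0 // ltW.
  have := sqr_ge0 d; have := sqr_ge0 s; lra.
lra.
Qed.

End Cubic.

(** * Assembling the spectrum of the corona *)

(** This allows the evaluation point to be taken so large that all denominators are nonzero. *)
Lemma eq_poly_nat_ge (R : numDomainType) (p q : {poly R}) (a : nat) :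
  (forall m : nat, (a <= m)%N -> p.[m%:R] = q.[m%:R]) -> p = q.
Proof.
move=> pq; apply/eqP; rewrite -subr_eq0; apply/eqP.
apply: (@roots_geq_poly_eq0 _ _ [seq m%:R | m <- iota a (size (p - q)%R)]).
- apply/allP => x /mapP[m]; rewrite mem_iota => /andP[am _] ->.
  by rewrite /root hornerD hornerN pq // subrr.
- by rewrite map_inj_uniq ?iota_uniq // => i j /eqP; rewrite eqr_nat => /eqP.
- by rewrite size_map size_iota.
Qed.

(** By symmetry the solution takes one value [c] at the center and one value [l] on all leaves, with
    [x c - n.+1 l = 1] and [x l - c = 1]. *)
Lemma star_coronal (R : realType) (n : nat) (x : R) : x ^+ 2 - n.+1%:R != 0 ->
  exists y : 'I_n.+2 -> R,
    (forall v, \sum_w (x *+ (v == w) - (star_edge v w)%:R) * y w = 1)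
    /\ \sum_w y w = (n.+2%:R * x + 2 * n.+1%:R) / (x ^+ 2 - n.+1%:R).
Proof.
set D := _ - _ => D0.
pose c := (x + n.+1%:R) / D; pose l := (x + 1) / D.
have lsum (P : 'I_n.+1 -> R) a : (forall i, P i = a) -> \sum_i P i = n.+1%:R * a.
  by move=> Pa; rewrite (eq_bigr (fun=> a)) // sumr_const card_ord mulr_natl.
exists (fun w => if w == ord0 then c else l); split; last first.
  rewrite big_ord_recl eqxx (lsum _ l) // /c /l -[n.+2]addn1 natrD.
  by field.
move=> v; rewrite big_ord_recl eqxx; have [i|] := unliftP ord0 v => ->.
  rewrite (bigD1 i) //= big1 ?addr0 => [|j /negPf nj]; last first.
    by rewrite (inj_eq lift_inj) eq_sym nj /star_edge /= andbF subr0 mul0r.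
  rewrite eqxx /star_edge /= eqxx /= /c /l mulr1n mulr0n subr0.
  by rewrite -[RHS](divff D0) {3}/D; field.
rewrite eqxx /star_edge eqxx /= (lsum _ (- l)); last first.
  by move=> i; rewrite mulr0n sub0r mulN1r.
by rewrite mulr1n subr0 /c /l -[RHS](divff D0) {3}/D; field.
Qed.

Theorem theorem5 (R : realType) (k : nat) (mu : k.-tuple R) :
  (3 <= k)%N ->
  is_spectrum (adjmx R (star k)) mu ->
  is_spectrum (adjmx R (corona (star k) (star k)))
    ([seq lambda k (tnth mu i) z | i <- enum 'I_k, z <- enum 'I_3]
       ++ nseq (k * (k - 2))%N 0)
  /\ (forall (i : 'I_k) (z : 'I_3),
        let m := `|tnth mu i| in
        let r := Num.sqrt (6 * k%:R - 3) in
        lambda k (tnth mu i) z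
          \in `[- m + 2 * m / 3 - 2 * r / 3, m + 2 * r / 3]).
Proof.
move=> k3 spec_star.
case: k k3 mu spec_star => [|[|n]] // k3 mu; rewrite /is_spectrum big_tuple => spec_star.
have nE : n.+2%:R - 1 = n.+1%:R :> R by rewrite -[n.+2]addn1 natrD addrK.
split; last first.
  move=> i z; apply: lambda_itv => //; rewrite nE.
  (* A nonzero eigenvalue of the star is a root of [x^n (x^2 - n.+1)], hence of its second
     factor. *)
  have [->|m0] := eqVneq (tnth mu i) 0; [by left | right].
  apply/eqP; rewrite -subr_eq0.
  have := horner_char_poly_star n m0; rewrite spec_star horner_prod.
  rewrite (bigD1 i) //= hornerXsubC subrr mul0r => /esym/eqP.
  by rewrite mulf_eq0 expf_eq0 (negPf m0) andbF.
apply: (@eq_poly_nat_ge _ _ _ n.+2) => a na; set x : R := a%:R.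
have nx : n.+2%:R <= x by rewrite ler_nat.
have n0 : 0 <= n.+1%:R :> R by rewrite ler0n.
have D0 : x ^+ 2 - n.+1%:R != 0 by rewrite gt_eqF // expr2; nra.
have x0 : x != 0 by rewrite gt_eqF //; lra.
have [y [Ny sum_y]] := star_coronal D0.
rewrite (horner_char_poly_corona (star n.+2) (G2 := star n.+2) Ny) sum_y.
rewrite (horner_char_poly_star n x0) spec_star card_ord.
rewrite big_cat hornerM big_allpairs_dep !horner_prod big_enum /=.
have -> : \prod_(t <- nseq (n.+2 * (n.+2 - 2)) (0 : R)) ('X - t%:P).[x] = (x ^+ n) ^+ n.+2.
  by rewrite big_nseq iter_mulr_1 hornerXsubC subr0 subn2 mulnC exprM.
rewrite exprMn mulrCA [RHS]mulrC; congr (_ * _).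
set D := x ^+ 2 - _ in D0 *.
(* The power of [D] supplies one factor for each [mu_i], which cancels the denominator of the
   coronal and leaves the cubic. *)
rewrite -[X in D ^+ X]card_ord -prodr_const -big_split /=; apply: eq_bigr => i _.
rewrite horner_prod big_enum /= (eq_bigr (fun z => x - lambda n.+2 (tnth mu i) z)).
  by rewrite prod_lambda // nE hornerXsubC -/D; field.
by move=> z _; rewrite hornerXsubC.
Qed.
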